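(* Let $(\{v_j\},\{p_j\})$ be a sequential norming pair for $\mathbb{R}$ such that $$p_j\left\lfloor\frac{|v_{j+1}|}{|v_j|}-1\right\rfloor\ge 1\quad\text{for all but finitely many } j,$$ and let $(G_v,\sigma_v)$ be the topological group generated by $(\{v_j\},\{p_j\})$. Let $\tau$ denote the standard topology on $\mathbb{R}$ and also the subspace topology it induces on $G_v$. If $\{v_j\}$ generates a dense subgroup of $(\mathbb{R},\tau)$, then the topologies of $(G_v,\sigma_v)$ and $(G_v,\tau)$ are not comparable, i.e. neither of these two topologies on $G_v$ contains the other.
   Context: All sequences are indexed by $\mathbb{N}=\{1,2,\dots\}$, and $\lfloor x\rfloor$ is the greatest integer less than or equal to $x$. A sequential norming pair (SNP) for $\mathbb{R}$ is a pair $(\{v_j\},\{p_j\})$ where $\{p_j\}$ is a nonincreasing sequence of positive real numbers converging to $0$, and $\{v_j\}$ is a sequence in $\mathbb{R}\setminus\{0\}$ such that $\{|v_j|\}$ is nondecreasing and $\{p_{j+1}|v_{j+1}|/|v_j|\}$ has a positive lower bound. The topological group generated by an SNP $(\{v_j\},\{p_j\})$ is $(G_v,\sigma_v)$, where $G_v$ is the subgroup of $\mathbb{R}$ generated by $\{v_j\}$ and $\sigma_v(x)=\inf\{\sum |c_j|p_j : x=\sum c_jv_j,\ c_j\in\mathbb{Z}\}$ (finite sums). $\sigma_v$ induces the translation-invariant metric $d(x,y)=\sigma_v(x-y)$ and a metrizable group topology on $G_v$ (known). *)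

(* Defs.v *)
From HB Require Import structures.
From mathcomp Require Import all_boot all_order all_algebra.
From mathcomp Require Import all_classical all_reals all_analysis.

Set Implicit Arguments.
Unset Strict Implicit.
Unset Printing Implicit Defensive.

Import Order.TTheory GRing.Theory Num.Theory.
Import numFieldNormedType.Exports.

Local Open Scope classical_set_scope.
Local Open Scope ring_scope.

(* Sequences are indexed from 0; index j here is index j + 1 for sequences
   indexed by {1, 2, ...}. *)

Record is_SNP (R : realType) (v p : nat -> R) : Prop := IsSNP {
  snp_p_gt0 : forall j, 0 < p j;
  snp_p_nincr : nonincreasing_seq p;
  snp_p_cvg0 : p @ \oo --> (0 : R);
  snp_v_neq0 : forall j, v j != 0;
  snp_v_ndecr : nondecreasing_seq (fun j => `|v j|);
  snp_ratio : exists2 c : R, 0 < c &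
    forall j, c <= p j.+1 * `|v j.+1| / `|v j|
}.

Definition gen_subgroup (R : realType) (A : set R) : set R :=
  smallest (fun H : set R => zmod_closed [in H]) A.

Definition G_ (R : realType) (v : nat -> R) : set R := gen_subgroup (range v).

(* A finite sum is a sum over j < n for some n, zero coefficients being
   allowed. On G_ v the set below is nonempty, so [inf] takes its usual value. *)
Definition sigma_ (R : realType) (v p : nat -> R) (x : R) : R :=
  inf [set s | exists (n : nat) (c : nat -> int),
         x = \sum_(j < n) (c j)%:~R * v j /\
         s = \sum_(j < n) `|(c j)%:~R| * p j].

(* The type [G_ v] is the subtype of [R] given by the set [G_ v]. *)
Definition dist_ (R : realType) (v p : nat -> R) (x y : G_ v) : R :=
  sigma_ v p (set_val x - set_val y).

Definition metric_topology (R : realType) (T : Type) (d : T -> T -> R) :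
    set (set T) :=
  [set U | forall x, U x ->
     exists2 e : R, 0 < e & forall y, d x y < e -> U y].

Definition sigma_topology (R : realType) (v p : nat -> R) :
    set (set (G_ v)) :=
  metric_topology (@dist_ R v p).
Arguments sigma_topology {R} v p.

(* The library's topology on the subtype [G_ v] is the initial topology of the
   inclusion into [R], that is, the subspace topology. *)
Definition tau_topology (R : realType) (v : nat -> R) : set (set (G_ v)) :=
  [set U | open U].
Arguments tau_topology {R} v.

(* Main.v *)
(* The floor condition gives |v_j| <= p_j |v_(j+1)| for j >= N. A representation
   of cost less than p_N has zero coefficients before N, and if its cost is also
   at most 1/2, then its top nonzero term dominates the sum of the others, so
   |x| >= |v_0| / 2 unless x = 0. Hence a small sigma-ball meets a
   tau-neighbourhood of 0 only in 0, which density forbids if the ball is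
   tau-open. Conversely v_j tends to 0 for sigma, since sigma (v_j) <= p_j,
   while |v_j| >= |v_0|. *)

Require Import Defs.
From HB Require Import structures.
From mathcomp Require Import all_boot all_order all_algebra.
From mathcomp Require Import all_classical all_reals all_analysis.
From mathcomp Require Import lra.

Set Implicit Arguments.
Unset Strict Implicit.
Unset Printing Implicit Defensive.

Import Order.TTheory GRing.Theory Num.Theory.
Import numFieldNormedType.Exports.
Local Open Scope classical_set_scope.
Local Open Scope ring_scope.

Section SequentialNormingPair.
Context {R : realType}.
Implicit Types (v p : nat -> R) (x y s t : R) (c : nat -> int).

(** The set whose infimum is [sigma_ v p x]. Most of the argument uses its elements, actual
    representations with a cost, instead of the infimum. *)
Definition rep_cost v p x : set R :=
  [set s | exists (n : nat) (c : nat -> int),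
     x = \sum_(j < n) (c j)%:~R * v j /\
     s = \sum_(j < n) `|(c j)%:~R| * p j].

(** Padding with zero coefficients brings two representations to a common length. The abstract [F]
    covers both the value sum and the cost sum. *)
Lemma sum_int_widen (F : R -> nat -> R) n m c : (forall j, F 0 j = 0) ->
  (n <= m)%N ->
  \sum_(j < n) F (c j)%:~R j =
  \sum_(j < m) F (if (j < n)%N then c j else 0)%:~R j.
Proof.
move=> F0 nm; rewrite (big_ord_widen m (fun j => F (c j)%:~R j)) // big_mkcond.
by apply: eq_bigr => j _; case: ifP => // _; rewrite F0.
Qed.

Lemma rep_cost_widen v p x s n c m : (n <= m)%N ->
  x = \sum_(j < n) (c j)%:~R * v j -> s = \sum_(j < n) `|(c j)%:~R| * p j ->
  exists c', x = \sum_(j < m) (c' j)%:~R * v j /\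
             s = \sum_(j < m) `|(c' j)%:~R| * p j.
Proof.
move=> nm -> ->; exists (fun j => if (j < n)%N then c j else 0); split.
  by apply (@sum_int_widen (fun a j => a * v j)) => // j; rewrite mul0r.
by apply (@sum_int_widen (fun a j => `|a| * p j)) => // j; rewrite normr0 mul0r.
Qed.

(** Coefficients are subtracted termwise; cancellation can lower the cost, hence only
    [u <= s + t]. *)
Lemma rep_costB v p x y s t : (forall j, 0 <= p j) ->
  rep_cost v p x s -> rep_cost v p y t ->
  exists2 u, u <= s + t & rep_cost v p (x - y) u.
Proof.
move=> p0 [n [c [xE sE]]] [m [d [yE tE]]].
have [c' [-> ->]] := @rep_cost_widen v p x s n c _ (leq_maxl n m) xE sE.
have [d' [-> ->]] := @rep_cost_widen v p y t m d _ (leq_maxr n m) yE tE.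
exists (\sum_(j < maxn n m) `|(c' j - d' j)%:~R| * p j); last first.
  exists (maxn n m), (fun j => c' j - d' j); split=> //.
  by rewrite -sumrB; apply: eq_bigr => j _; rewrite rmorphB mulrBl.
rewrite -big_split; apply: ler_sum => j _ /=.
by rewrite -mulrDl ler_wpM2r// rmorphB ler_normB.
Qed.

Lemma rep_cost_ge0 v p x s : (forall j, 0 <= p j) -> rep_cost v p x s -> 0 <= s.
Proof. by move=> p0 [n [c [_ ->]]]; apply: sumr_ge0 => j _; rewrite mulr_ge0. Qed.

Lemma rep_cost_gen v p j : rep_cost v p (v j) (p j).
Proof.
have sum1 (w : nat -> R) (f : int -> R) : f 0 = 0 -> f 1 = 1 ->
    w j = \sum_(i < j.+1) f (i == j :> nat)%:Z * w i.
  move=> f0 f1; rewrite big_ord_recr /= eqxx f1 mul1r big1 ?add0r// => i _.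
  by rewrite ltn_eqF// f0 mul0r.
exists j.+1, (fun i => (i == j :> nat)%:Z); split.
  exact: (sum1 v (fun a => a%:~R)).
by apply: (sum1 p (fun a => `|a%:~R|)); rewrite ?normr0 ?normr1.
Qed.

Lemma rep_cost0 v p : rep_cost v p 0 0.
Proof. by exists 0, (fun=> 0); rewrite !big_ord0. Qed.

(** The representable reals form a subgroup containing every [v j], so they include the smallest
    one. *)
Lemma G_rep_cost v p x : (forall j, 0 <= p j) -> G_ v x ->
  rep_cost v p x !=set0.
Proof.
move=> p0; pose H := [set x | rep_cost v p x !=set0].
suff : G_ v `<=` H by apply.
apply: smallest_sub; last by move=> _ [j _ <-]; exists (p j); exact: rep_cost_gen.
split=> [|a b]; rewrite !inE; first by exists 0; exact: rep_cost0.
by move=> [s sa] [t tb]; have [u _ ?] := rep_costB p0 sa tb; exists u.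
Qed.

Lemma sigma_ltP v p x e : (forall j, 0 <= p j) -> G_ v x ->
  sigma_ v p x < e -> exists2 s, rep_cost v p x s & s < e.
Proof. by move=> p0 Gx; apply: inf_lt; exact: G_rep_cost. Qed.

Lemma sigma_le v p x s : (forall j, 0 <= p j) -> rep_cost v p x s ->
  sigma_ v p x <= s.
Proof. by move=> p0 xs; apply: ge_inf => //; exists 0 => t /(rep_cost_ge0 p0). Qed.

Lemma G_zmod_closed v : zmod_closed [in G_ v].
Proof.
split=> [|x y]; rewrite !inE.
  by move=> H [[H0 _] _]; rewrite inE in H0.
move=> Gx Gy H HP; have [[_ HB] _] := HP.
by have := HB x y; rewrite !inE; apply; [exact: Gx|exact: Gy].
Qed.

Lemma G_0 v : G_ v 0.
Proof. by have [] := G_zmod_closed v; rewrite inE. Qed.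

Lemma G_B v x y : G_ v x -> G_ v y -> G_ v (x - y).
Proof. by move=> Gx Gy; have [_ /(_ x y)] := G_zmod_closed v; rewrite !inE; apply. Qed.

Lemma G_gen v j : G_ v (v j).
Proof. by apply: sub_gen_smallest; exists j. Qed.

Section GapCondition.
Variables (v p : nat -> R) (N : nat).
Hypotheses (p_gt0 : forall j, 0 < p j) (p_nincr : nonincreasing_seq p)
  (v_ndecr : nondecreasing_seq (fun j => `|v j|))
  (gap : forall j, (N <= j)%N -> `|v j| <= p j * `|v j.+1|).

(** A nonzero integer coefficient at some [j < N] alone costs at least [p j >= p N]. *)
Lemma cheap_coef_eq0 n c : \sum_(j < n) `|(c j)%:~R| * p j < p N ->
  forall j, (j < n)%N -> (j < N)%N -> c j = 0.
Proof.
move=> cost j jn jN; apply: contraTeq cost => cj0; rewrite -leNgt.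
rewrite (bigD1 (Ordinal jn)) //= -[leLHS]addr0 lerD//.
  rewrite (le_trans (p_nincr (ltnW jN)))// ler_peMl ?(ltW (p_gt0 _))//.
  by rewrite -intr_norm ler1z -gtz0_ge1 normr_gt0.
by apply: sumr_ge0 => i _; rewrite mulr_ge0// ltW.
Qed.

(** By induction: monotonicity of [|v j|] carries the earlier terms from [v n] to [v n.+1], and
    [gap] bounds the new term. Below [N], where [gap] says nothing, the terms vanish. *)
Lemma sum_norm_le_cost n c :
  (forall j, (j < n)%N -> (j < N)%N -> c j = 0) ->
  \sum_(j < n) `|(c j)%:~R * v j| <= (\sum_(j < n) `|(c j)%:~R| * p j) * `|v n|.
Proof.
elim: n => [|n IHn] c0; first by rewrite !big_ord0 mul0r.
rewrite !big_ord_recr /= mulrDl lerD//.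
  apply: le_trans (IHn _) _ => [j jn|]; first by apply: c0; exact: ltnW.
  apply: ler_wpM2l; last exact: (v_ndecr (leqnSn n)).
  by apply: sumr_ge0 => i _; rewrite mulr_ge0// ltW.
have [nN|Nn] := ltnP n N; first by rewrite c0// mul0r normr0 !mul0r.
by rewrite normrM -mulrA ler_wpM2l// gap.
Qed.

Lemma cheap_eq0_or_large x s : s <= 2^-1 -> s < p N ->
  rep_cost v p x s -> x = 0 \/ `|v 0| / 2 <= `|x|.
Proof.
move=> + + [n [c [-> sE]]]; rewrite {s}sE; elim: n => [|n IHn] s2 sN.
  by left; rewrite big_ord0.
(* Zero top coefficients are peeled off by induction until the last one is nonzero. *)
have [cn0|cn0] := eqVneq (c n) 0.
  move: s2 sN; rewrite !big_ord_recr /= cn0 normr0 !mul0r !addr0; exact: IHn.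
right; have c0 j : (j < n)%N -> (j < N)%N -> c j = 0.
  by move=> jn; apply: cheap_coef_eq0 sN _ _; exact: ltnW.
have := sum_norm_le_cost c0.
have := v_ndecr (leq0n n).
have := ler_norm_sum (index_enum 'I_n) (fun j => (c j)%:~R * v j) xpredT.
move: s2; rewrite !big_ord_recr /=.
set a := \sum_(j < n) _ * v _; set b := \sum_(j < n) `|_|; set k := \sum_(j < n) _.
have kn : 0 <= `|(c n)%:~R| * p n by rewrite mulr_ge0// ltW.
have vn : `|v n| <= `|(c n)%:~R * v n|.
  by rewrite normrM ler_peMl// -intr_norm ler1z -gtz0_ge1 normr_gt0.
have := lerB_normD ((c n)%:~R * v n) a; rewrite (addrC _ a) => tri k2 ab v0 bk.
(* [k] is the cost without the top term, so it is still at most 1/2; the lower terms then cancel at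
   most half of [|v n|]. *)
have : k * `|v n| <= 2^-1 * `|v n| by rewrite ler_wpM2r//; lra.
by lra.
Qed.

End GapCondition.

Lemma sigma_not_sub_tau v p N :
  (forall j, 0 < p j) -> nonincreasing_seq p -> v 0 != 0 ->
  nondecreasing_seq (fun j => `|v j|) ->
  (forall j, (N <= j)%N -> `|v j| <= p j * `|v j.+1|) ->
  dense (G_ v) -> ~ (sigma_topology v p `<=` tau_topology v).
Proof.
move=> p_gt0 p_nincr v0 v_ndecr gap Gdense sub.
have p_ge0 j : 0 <= p j by exact: ltW.
pose e := Num.min 2^-1 (p N).
have e_gt0 : 0 < e by rewrite lt_min p_gt0 invr_gt0 ltr0n.
(* The sigma-ball of radius [e] about 0, phrased by costs so that [rep_costB] serves as the triangle
   inequality. *)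
pose U := [set x : G_ v | exists2 s, rep_cost v p (set_val x) s & s < e].
have /sub : sigma_topology v p U.
  move=> x [s xs se]; exists (e - s); first by rewrite subr_gt0.
  move=> y xy; have xyG : G_ v (set_val x - set_val y).
    by apply: G_B; exact: set_valP.
  have [t xyt ts] := sigma_ltP p_ge0 xyG xy.
  have [u us xu] := rep_costB p_ge0 xs xyt; rewrite subKr in xu.
  by exists u => //; apply: le_lt_trans us _; lra.
(* [U] is now the trace on [G_ v] of an open set [V] of the reals. *)
move=> [V Vo VU].
have zG : 0 \in G_ v by rewrite inE; exact: G_0.
have : nbhs (0 : R) V.
  apply: open_nbhs_nbhs; split=> //.
  suff : (set_val @^-1` V) (SigSub zG : G_ v) by [].
  by rewrite VU; exists 0 => //; exact: rep_cost0.
move=> /nbhs_ballP[d /= d0 dV].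
pose r := Num.min d (`|v 0| / 2).
have r0 : 0 < r by rewrite lt_min d0 divr_gt0// normr_gt0.
(* Excluding the endpoint 0 makes the point given by density nonzero. *)
have [||x [xI Gx]] := Gdense `]0, r[%classic.
- by exists (r / 2); rewrite /= in_itv /=; apply/andP; split; lra.
- exact: interval_open.
move: xI; rewrite /= in_itv /= => /andP[x0 xr].
move: xr; rewrite lt_min => /andP[xd xv].
have xG : x \in G_ v by rewrite inE.
have : U (SigSub xG : G_ v).
  rewrite -VU; apply: dV.
  by rewrite /ball /= sub0r normrN gtr0_norm.
move=> [s]; rewrite lt_min -[set_val _]/x => xs /andP[s2 sN].
have [x0'|] := cheap_eq0_or_large p_gt0 p_nincr v_ndecr gap (ltW s2) sN xs.
  by move: x0; rewrite x0' ltxx.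
by rewrite (gtr0_norm x0) leNgt xv.
Qed.

Lemma tau_not_sub_sigma v p :
  (forall j, 0 < p j) -> p @ \oo --> (0 : R) -> v 0 != 0 ->
  nondecreasing_seq (fun j => `|v j|) ->
  ~ (tau_topology v `<=` sigma_topology v p).
Proof.
move=> p_gt0 p_cvg0 v0 v_ndecr sub.
have p_ge0 j : 0 <= p j by exact: ltW.
have /sub : tau_topology v (set_val @^-1` ball (0 : R) `|v 0|).
  by exists (ball (0 : R) `|v 0|) => //; apply: ball_open; rewrite normr_gt0.
have zG : 0 \in G_ v by rewrite inE; exact: G_0.
move=> /(_ (SigSub zG)) []; first by apply: ballxx; rewrite normr_gt0.
move=> e e0 sball.
have /cvgrPdist_lt/(_ _ e0)[n _ /(_ n (leqnn n))] := p_cvg0.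
rewrite sub0r normrN gtr0_norm// => pe.
have vG : v n \in G_ v by rewrite inE; exact: G_gen.
have /sball : dist_ (v := v) p (SigSub zG) (SigSub vG) < e.
  (* The distance is [sigma_] of [0 - v n], so the representation of [v n] is subtracted from the
     empty one. *)
  apply: le_lt_trans pe.
  have [u up vu] := rep_costB p_ge0 (rep_cost0 v p) (rep_cost_gen v p n).
  by apply: le_trans (sigma_le p_ge0 vu) _; rewrite add0r in up.
by rewrite /ball /= sub0r normrN ltNge (v_ndecr 0 n).
Qed.

End SequentialNormingPair.

Theorem proposition4p5 (R : realType) (v p : nat -> R)
  (hSNP : is_SNP v p)
  (hfloor : \forall j \near \oo,
     1 <= p j * (Num.floor (`|v j.+1| / `|v j| - 1))%:~R)
  (hdense : dense (G_ v)) :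
  ~ (sigma_topology v p `<=` tau_topology v) /\
  ~ (tau_topology v `<=` sigma_topology v p).
Proof.
case: hSNP => p_gt0 p_nincr p_cvg0 v_neq0 v_ndecr _.
split; last exact: tau_not_sub_sigma.
have [N _ hN] := hfloor.
apply: (@sigma_not_sub_tau _ v p N) => // j /hN /= floor_ge.
have vj : 0 < `|v j| by rewrite normr_gt0.
(* The floor of [t - 1] is at most [t], so the hypothesis bounds [p j] times the ratio below by
   1. *)
have : p j * (Num.floor (`|v j.+1| / `|v j| - 1))%:~R <=
    p j * (`|v j.+1| / `|v j|).
  rewrite ler_wpM2l ?(ltW (p_gt0 j))// (le_trans (floor_le _))// gerBl.
  exact: ler01.
by move=> /(le_trans floor_ge); rewrite mulrA ler_pdivlMr// mul1r.
Qed.
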